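(* Let $\Omega\subseteq\mathbb{R}$ be an infinite set, let $\Lambda$ be the family of finite subsets of $\Omega$, and let ${}^{\ast}\mathbb{R}=\mathbb{R}^{\Lambda}/\mathcal{U}$, where $\mathcal{U}$ is a fine and free ultrafilter on $\Lambda$. Let $P\colon\mathcal{P}(\Omega)\to{}^{\ast}\mathbb{R}$ be a probability measure that satisfies the $\Omega$-limit axiom. Let $\Omega_\Lambda$ be the hyperfinite set $$\Omega_\Lambda=\Bigl\{\lim_{\lambda\uparrow\Omega} f(\lambda)\;:\; f\colon\Lambda\to\mathbb{R}\text{ and } f(\lambda)\in\lambda \text{ for every nonempty } \lambda\in\Lambda\Bigr\},$$ and let $\overline{P}\colon{}^{\ast}\mathcal{P}(\Omega_\Lambda)\to{}^{\ast}\mathbb{R}$ be the internal uniform probability measure $\overline{P}(A)=\dfrac{|A|}{|\Omega_\Lambda|}$. Suppose that $\phi\colon{}^{\ast}\mathbb{R}\to{}^{\ast}\mathbb{R}$ is a field automorphism. Then the measure $\overline{P}_\phi=\phi\circ\overline{P}$ is internal if and only if the restriction of $\phi$ to the range of $\overline{P}$ is the identity.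
   Context: An ultrafilter $\mathcal{U}$ on $\Lambda$ is fine if for every $\lambda\in\Lambda$ the set $\{L\in\Lambda:\lambda\subseteq L\}$ belongs to $\mathcal{U}$; it is free if it has no $\subseteq$-least element (i.e. is nonprincipal). The field ${}^{\ast}\mathbb{R}=\mathbb{R}^\Lambda/\mathcal{U}$ is a hyperreal field, and the nonstandard extension ${}^{\ast}$ is the ultrapower extension by $\mathcal{U}$, which satisfies the transfer principle. A set or function is internal if it is an element of the $\ast$-extension of some classical (standard) set (equivalently, it is represented by an ultraproduct modulo $\mathcal{U}$ of a $\Lambda$-indexed family of classical sets or functions), and external otherwise. A hyperfinite set is an internal set that is in internal bijection with $\{1,\dots,N\}$ for some $N\in{}^{\ast}\mathbb{N}$. For internal hyperfinite $A$, $|A|\in{}^{\ast}\mathbb{N}$ denotes its internal cardinality. ${}^{\ast}\mathcal{P}(\Omega_\Lambda)$ denotes the set of internal subsets of $\Omega_\Lambda$. An $\Omega$-limit in an ordered field $F\supset\mathbb{R}$ is a correspondence assigning to each $f\colon\Lambda\to\mathbb{R}$ an element $\lim_{\lambda\uparrow\Omega}f(\lambda)\in F$ such that: (1) if there are $\overline\lambda\in\Lambda$ and $c\in\mathbb{R}$ with $f(\lambda)=c$ for every $\lambda\supseteq\overline\lambda$, then $\lim_{\lambda\uparrow\Omega}f(\lambda)=c$; (2) for all $f,g\colon\Lambda\to\mathbb{R}$, the limit of the pointwise sum is the sum of the limits and the limit of the pointwise product is the product of the limits. The $\Omega$-limit used here is $\lim_{\lambda\uparrow\Omega}f(\lambda)=[f]_{\mathcal{U}}\in{}^{\ast}\mathbb{R}$.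 A probability measure $P\colon\mathcal{P}(\Omega)\to{}^{\ast}\mathbb{R}$ (nonnegative, finitely additive, $P(\Omega)=1$) satisfies the $\Omega$-limit axiom if $P(A)=\lim_{\lambda\uparrow\Omega}P(A|\lambda)$ for every $A\subseteq\Omega$, where $P(A|\lambda)=P(A\cap\lambda)/P(\lambda)$; it is implicit that for nonempty $\lambda\in\Lambda$ one has $P(\lambda)>0$ and $P(A|\lambda)\in\mathbb{R}$ (the value assigned at $\lambda=\emptyset$ is irrelevant). *)

(* Defs.v *)
From HB Require Import structures.
From mathcomp Require Import all_boot all_order all_algebra finmap.
From mathcomp Require Import generic_quotient.
From mathcomp Require Import boolp classical_sets functions cardinality filter.
From mathcomp Require Import reals.

Set Implicit Arguments.
Unset Strict Implicit.
Unset Printing Implicit Defensive.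

Import Order.TTheory GRing.Theory Num.Theory.

Local Open Scope classical_set_scope.
Local Open Scope ring_scope.

Record ultrafilter_on (I : Type) := UltrafilterOn {
  ultrafilter_sets :> (I -> Prop) -> Prop;
  ultrafilter_onP : UltraFilter ultrafilter_sets }.

#[global] Existing Instance ultrafilter_onP.

(* A principal ultrafilter is one that has a least element for inclusion. *)
Definition free_ultrafilter (I : Type) (U : ultrafilter_on I) : Prop :=
  ~ exists A : set I, U A /\ (forall B : set I, U B -> A `<=` B).

Section Ultrapower.
Variables (I : Type) (U : ultrafilter_on I) (F : realFieldType).

Definition ueq (f g : I -> F) : bool := `[< U [set i | f i = g i] >].

Lemma ueq_refl : reflexive ueq.
Proof.
move=> f; apply/asboolP.
by apply: (filterS _ (filterT : ultrafilter_sets U setT)) => i _ /=.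
Qed.

Lemma ueq_sym : symmetric ueq.
Proof.
move=> f g; apply/idP/idP => /asboolP h; apply/asboolP;
  by apply: filterS h => i /= ->.
Qed.

Lemma ueq_trans : transitive ueq.
Proof.
move=> g f h /asboolP fg /asboolP gh; apply/asboolP.
by apply: filterS2 fg gh => i /= -> ->.
Qed.

Canonical ueq_equiv := EquivRel ueq ueq_refl ueq_sym ueq_trans.

Definition ultrapower : Type := {eq_quot ueq}%qT.

HB.instance Definition _ : EqQuotient _ ueq ultrapower :=
  EqQuotient.on ultrapower.
HB.instance Definition _ := Choice.on ultrapower.

(* The class of [f] modulo [U]; this is the limit of [f] along the index set. *)
Definition ulim (f : I -> F) : ultrapower := (\pi_ultrapower f)%qT.

Lemma ulimP (f g : I -> F) : ulim f = ulim g <-> U [set i | f i = g i].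
Proof.
split=> [/eqmodP/asboolP //|h].
by apply/eqmodP/asboolP.
Qed.

Lemma ulim_repr (x : ultrapower) : ulim (repr x) = x.
Proof. exact: reprK. Qed.

Lemma repr_ulim (f : I -> F) : U [set i | repr (ulim f) i = f i].
Proof. by apply/ulimP; rewrite ulim_repr. Qed.

Lemma ulimW (P : ultrapower -> Prop) : (forall f, P (ulim f)) -> forall x, P x.
Proof. by move=> h x; rewrite -(ulim_repr x). Qed.

Definition uadd (x y : ultrapower) := ulim (fun i => repr x i + repr y i).
Definition uopp (x : ultrapower) := ulim (fun i => - repr x i).
Definition umul (x y : ultrapower) := ulim (fun i => repr x i * repr y i).
Definition uinv (x : ultrapower) := ulim (fun i => (repr x i)^-1).

Lemma uaddE f g : uadd (ulim f) (ulim g) = ulim (fun i => f i + g i).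
Proof.
by apply/ulimP; apply: filterS2 (repr_ulim f) (repr_ulim g) => i /= -> ->.
Qed.

Lemma uoppE f : uopp (ulim f) = ulim (fun i => - f i).
Proof. by apply/ulimP; apply: filterS (repr_ulim f) => i /= ->. Qed.

Lemma umulE f g : umul (ulim f) (ulim g) = ulim (fun i => f i * g i).
Proof.
by apply/ulimP; apply: filterS2 (repr_ulim f) (repr_ulim g) => i /= -> ->.
Qed.

Lemma uinvE f : uinv (ulim f) = ulim (fun i => (f i)^-1).
Proof. by apply/ulimP; apply: filterS (repr_ulim f) => i /= ->. Qed.

Let ulim_ext f g : f =1 g -> ulim f = ulim g.
Proof. by move=> /funext ->. Qed.

Lemma uaddA : associative uadd.
Proof.
elim/ulimW=> f; elim/ulimW=> g; elim/ulimW=> h.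
by rewrite !uaddE; apply: ulim_ext => i; rewrite addrA.
Qed.

Lemma uaddC : commutative uadd.
Proof.
elim/ulimW=> f; elim/ulimW=> g.
by rewrite !uaddE; apply: ulim_ext => i; rewrite addrC.
Qed.

Lemma uadd0 : left_id (ulim (fun=> 0)) uadd.
Proof.
by elim/ulimW=> f; rewrite uaddE; apply: ulim_ext => i; rewrite add0r.
Qed.

Lemma uaddN : left_inverse (ulim (fun=> 0)) uopp uadd.
Proof.
by elim/ulimW=> f; rewrite uoppE uaddE; apply: ulim_ext => i; rewrite addNr.
Qed.

HB.instance Definition _ :=
  GRing.isZmodule.Build ultrapower uaddA uaddC uadd0 uaddN.

Lemma umulA : associative umul.
Proof.
elim/ulimW=> f; elim/ulimW=> g; elim/ulimW=> h.
by rewrite !umulE; apply: ulim_ext => i; rewrite mulrA.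
Qed.

Lemma umulC : commutative umul.
Proof.
elim/ulimW=> f; elim/ulimW=> g.
by rewrite !umulE; apply: ulim_ext => i; rewrite mulrC.
Qed.

Lemma umul1 : left_id (ulim (fun=> 1)) umul.
Proof.
by elim/ulimW=> f; rewrite umulE; apply: ulim_ext => i; rewrite mul1r.
Qed.

Lemma umulDl : left_distributive umul uadd.
Proof.
elim/ulimW=> f; elim/ulimW=> g; elim/ulimW=> h.
by rewrite !(umulE, uaddE); apply: ulim_ext => i; rewrite mulrDl.
Qed.

Lemma uone_neq0 : ulim (fun=> 1) != 0.
Proof.
apply/eqP => /ulimP U0; apply: (filter_not_empty (ultrafilter_sets U)).
by apply: filterS U0 => i /= /eqP; rewrite oner_eq0.
Qed.

HB.instance Definition _ := GRing.Zmodule_isComNzRing.Build ultrapower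
  umulA umulC umul1 umulDl uone_neq0.

Lemma umulV (x : ultrapower) : x != 0 -> umul (uinv x) x = 1.
Proof.
elim/ulimW: x => f /eqP f0; rewrite uinvE umulE; apply/ulimP.
have [fz|fz] := in_ultra_setVsetC [set i | f i = 0] (ultrafilter_onP U).
  by exfalso; apply: f0; apply/ulimP.
by apply: filterS fz => i /= /eqP fi; rewrite mulVf.
Qed.

Lemma uinv0 : uinv 0 = 0.
Proof.
by rewrite [X in uinv X](_ : 0 = ulim (fun=> 0)) // uinvE invr0.
Qed.

HB.instance Definition _ :=
  GRing.ComNzRing_isField.Build ultrapower umulV uinv0.

Definition ule (x y : ultrapower) : bool :=
  `[< U [set i | repr x i <= repr y i] >].
Definition ult (x y : ultrapower) : bool := (y != x) && ule x y.
Definition unorm (x : ultrapower) := ulim (fun i => `|repr x i|).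

Lemma uleE f g : ule (ulim f) (ulim g) <-> U [set i | f i <= g i].
Proof.
have Uf := repr_ulim f; have Ug := repr_ulim g.
split=> [/asboolP h|h]; last apply/asboolP.
  by apply: filterS3 Uf Ug h => i /= -> ->.
by apply: filterS3 Uf Ug h => i /= -> ->.
Qed.

Let ule0E g : ule 0 (ulim g) <-> U [set i | 0 <= g i].
Proof. exact: (uleE (fun=> 0)). Qed.

Lemma ule0_add x y : ule 0 x -> ule 0 y -> ule 0 (x + y).
Proof.
elim/ulimW: x => f; elim/ulimW: y => g /ule0E f0 /ule0E g0.
rewrite [_ + _]uaddE; apply/ule0E.
by apply: filterS2 f0 g0 => i /=; exact: addr_ge0.
Qed.

Lemma ule0_mul x y : ule 0 x -> ule 0 y -> ule 0 (x * y).
Proof.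
elim/ulimW: x => f; elim/ulimW: y => g /ule0E f0 /ule0E g0.
rewrite [_ * _]umulE; apply/ule0E.
by apply: filterS2 f0 g0 => i /=; exact: mulr_ge0.
Qed.

Lemma ule0_anti x : ule 0 x -> ule x 0 -> x = 0.
Proof.
elim/ulimW: x => f /ule0E f0 /(uleE f (fun=> 0)) f0'.
apply/(ulimP f (fun=> 0)).
by apply: filterS2 f0 f0' => i /= a b; apply/eqP; rewrite eq_le a b.
Qed.

Lemma usub_ge0 x y : ule 0 (y - x) = ule x y.
Proof.
elim/ulimW: x => f; elim/ulimW: y => g.
rewrite [- _]uoppE [_ + _]uaddE.
apply/idP/idP => [/ule0E|/uleE] h; [apply/uleE|apply/ule0E];
  by apply: filterS h => i /=; rewrite subr_ge0.
Qed.

Lemma ule0_total x : ule 0 x || ule x 0.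
Proof.
elim/ulimW: x => f; apply/orP.
have [h|h] := in_ultra_setVsetC [set i | 0 <= f i] (ultrafilter_onP U).
  by left; apply/ule0E.
right; apply/(uleE f (fun=> 0)); apply: filterS h => i /= /negP.
by rewrite -ltNge => /ltW.
Qed.

Lemma unormN x : unorm (- x) = unorm x.
Proof.
elim/ulimW: x => f; rewrite [- _]uoppE; apply/ulimP.
apply: filterS2 (repr_ulim (fun i => - f i)) (repr_ulim f) => i /= -> ->.
exact: normrN.
Qed.

Lemma uge0_norm x : ule 0 x -> unorm x = x.
Proof.
elim/ulimW: x => f /ule0E h; apply/ulimP.
by apply: filterS2 h (repr_ulim f) => i /= fi ->; rewrite ger0_norm.
Qed.

HB.instance Definition _ := Num.IntegralDomain_isLeReal.Build ultrapower
  ule0_add ule0_mul ule0_anti usub_ge0 ule0_total unormN uge0_norm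
  (fun _ _ => erefl).

End Ultrapower.

Arguments ulim {I} U {F} f.

Section Internal.
Variables (I : Type) (U : ultrafilter_on I) (R : realType).
Local Notation starR := (ultrapower U R).

(* The ultraproduct of a family of subsets of R, as a subset of *R. *)
Definition uprod (a : I -> set R) : set starR :=
  [set ulim U f | f in [set f : I -> R | U [set i | a i (f i)]]].

Definition internal_set (A : set starR) : Prop := exists a, A = uprod a.

(* Every internal function between internal subsets of *R is the restriction *)
(* of such a total one.                                                      *)
Definition internal_map (h : starR -> starR) : Prop :=
  exists H : I -> R -> R,
    forall f : I -> R, h (ulim U f) = ulim U (fun i => H i (f i)).

Definition hypernat : set starR := uprod (fun=> range (fun n : nat => n%:R)).

(* [A] is hyperfinite, with N elements. *)
Definition has_hypercard (A : set starR) (N : starR) : Prop :=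
  [/\ internal_set A, hypernat N &
      exists2 h : starR -> starR, internal_map h &
        set_bij A [set k | hypernat k /\ 1 <= k <= N] h].

(* The internal cardinality, as an element of *N inside *R; the default value *)
(* 0 is only used when [A] is not hyperfinite.                                *)
Definition hypercard (A : set starR) : starR := xget 0 (has_hypercard A).

Definition internal_subsets (S : set starR) : set (set starR) :=
  [set A | internal_set A /\ A `<=` S].

(* A function on a collection D of internal sets is internal when it is the  *)
(* ultraproduct of functions H_i : d_i -> R with d_i a collection of subsets *)
(* of R (H_i is extended arbitrarily outside d_i, where it is not used).     *)
Definition internal_setfun (D : set (set starR)) (Q : D -> starR) : Prop :=
  exists (d : I -> set (set R)) (H : I -> set R -> R),
    D = [set uprod a | a in [set a | U [set i | d i (a i)]]] /\
    forall (A : D) (a : I -> set R),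
      set_val A = uprod a -> Q A = ulim U (fun i => H i (a i)).

End Internal.

Section OmegaLimit.
Variables (R : realType) (Omega : set R).

Definition finite_subsets : Type := {fset Omega}.

Variable U : ultrafilter_on finite_subsets.
Local Notation starR := (ultrapower U R).

Definition fine_ultrafilter : Prop :=
  forall l : {fset Omega}, U [set L : {fset Omega} | (l `<=` L)%fset].

Record is_probability (P : set Omega -> starR) : Prop := IsProbability {
  probability_ge0 : forall A, 0 <= P A;
  probability_additive :
    forall A B, A `&` B = set0 -> P (A `|` B) = P A + P B;
  probability_setT : P setT = 1 }.

Definition conditional (P : set Omega -> starR) (A : set Omega)
    (l : {fset Omega}) : starR :=
  P (A `&` [set` l]) / P [set` l].

(* The conditional probabilities given a nonempty finite set are real; the   *)
(* sequence whose limit is taken is arbitrary at the empty set.              *)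
Definition omega_limit_axiom (P : set Omega -> starR) : Prop :=
  (forall l : {fset Omega}, l != fset0 -> 0 < P [set` l]) /\
  forall A : set Omega, exists p : {fset Omega} -> R,
    (forall l, l != fset0 -> conditional P A l = ulim U (fun=> p l)) /\
    P A = ulim U p.

Definition Omega_Lambda : set starR :=
  [set ulim U f | f in [set f : {fset Omega} -> R |
     forall l, l != fset0 -> exists2 x : Omega, x \in l & f l = set_val x]].

Definition uniform_probability
    (A : internal_subsets Omega_Lambda) : starR :=
  hypercard (set_val A) / hypercard Omega_Lambda.

End OmegaLimit.

(* Main.v *)
(* The internal subsets of Omega_Lambda are the ultraproducts of families     *)
(* a_l of subsets of l, with internal cardinality the class of #|a_l|, so the *)
(* range of the uniform measure consists of the classes of n_l / #|l| with    *)
(* n_l <= #|l|. If its composite with phi is represented by functions H_l,    *)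
(* then choosing an n-element subset of each l gives phi [n_l / #|l|] =       *)
(* [K_l n_l] for real functions K_l of n <= #|l|. Since phi is additive and   *)
(* unital, for almost all l one has K_l (n + 1) = K_l n + K_l 1, K_l 0 = 0    *)
(* and K_l #|l| = 1 (any failure would be witnessed along a set in U); thus   *)
(* K_l n = n / #|l| by ordinary induction on n.                               *)
Require Import Defs.
From HB Require Import structures.
From mathcomp Require Import all_boot all_order all_algebra finmap.
From mathcomp Require Import generic_quotient.
From mathcomp Require Import boolp classical_sets functions cardinality filter.
From mathcomp Require Import reals.

Set Implicit Arguments.
Unset Strict Implicit.
Unset Printing Implicit Defensive.

Import Order.TTheory GRing.Theory Num.Theory.

Local Open Scope classical_set_scope.
Local Open Scope ring_scope.

(** If [phi] fixes the range, the composite is the uniform measure itself, which is the class of the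
    normalized counting measures on the sets l. Conversely, [phi] may be external, so hyperfinite
    induction cannot be run on it directly. Once its composite with the measure is internal,
    [internal_ratio_fixed] brings additivity and normalization down to almost every index, where
    ordinary induction forces the value n / #|l|. The descent rests on [ultra_forall] and
    [ultra_imp]; [internal_subsets_Omega_Lambda] and [hypercard_uprod] reduce internal subsets and
    their cardinalities to families of finite sets. *)

Section Transfer.
Variables (I : Type) (U : ultrafilter_on I).

Lemma ultra_imp (A B : set I) : (U A -> U B) -> U [set i | A i -> B i].
Proof.
move=> AB; have [/AB|] := in_ultra_setVsetC A (ultrafilter_onP U).
  by apply: filterS => i Bi _.
by apply: filterS => i nAi /nAi.
Qed.

(** Select a counterexample at each index that has one; the hypothesis on this single selection
    excludes counterexamples almost everywhere. *)
Lemma ultra_forall (T : Type) (t : T) (Q : I -> T -> Prop) :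
  (forall f : I -> T, U [set i | Q i (f i)]) -> U [set i | forall x, Q i x].
Proof.
move=> UQ.
have /choice[f fP] : forall i, exists x, Q i x -> forall y, Q i y.
  move=> i; have [Qi|/existsNP[x nQx]] := pselect (forall y, Q i y).
    by exists t.
  by exists x => /nQx.
by apply: filterS (UQ f) => i /=; exact: fP.
Qed.

End Transfer.

(** * Ultraproducts of sets of reals inside the ultrapower *)

Section UltrapowerOps.
Variables (I : Type) (U : ultrafilter_on I) (R : realType).

Lemma ulimD (f g : I -> R) : ulim U f + ulim U g = ulim U (fun i => f i + g i).
Proof. exact: uaddE. Qed.

Lemma ulim_div (f g : I -> R) :
  ulim U f / ulim U g = ulim U (fun i => f i / g i).
Proof. by rewrite [(ulim U g)^-1]uinvE [_ * _]umulE. Qed.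

Lemma ulim_le (f g : I -> R) :
  ulim U f <= ulim U g <-> U [set i | f i <= g i].
Proof. exact: uleE. Qed.

Lemma uprodE (a : I -> set R) (f : I -> R) :
  uprod (U:=U) a (ulim U f) <-> U [set i | a i (f i)].
Proof.
split=> [[g /= Ug /ulimP gf]|Uf]; last by exists f.
by apply: filterS2 Ug gf => i /= + <-.
Qed.

Lemma uprod_subset (a b : I -> set R) :
  uprod (U:=U) a `<=` uprod (U:=U) b <-> U [set i | a i `<=` b i].
Proof.
split=> [ab|ab _ [f /= Uf <-]]; last first.
  by apply/uprodE; apply: filterS2 ab Uf => i /= + ai; exact.
apply: (ultra_forall 0) => f; apply: ultra_imp => /uprodE/ab.
by move/uprodE.
Qed.

Lemma uprod_eq (a b : I -> set R) :
  U [set i | a i = b i] -> uprod (U:=U) a = uprod (U:=U) b.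
Proof.
by move=> ab; rewrite eqEsubset; split; apply/uprod_subset;
  apply: filterS ab => i /= ->.
Qed.

Lemma hypernatP (x : ultrapower U R) :
  hypernat x <-> exists n : I -> nat, x = ulim U (fun i => (n i)%:R).
Proof.
split=> [[f /= Uf <-]|[n ->]].
  exists (fun i => Num.truncn (f i)); apply/ulimP.
  by apply: filterS Uf => i /= -[n _ <-]; rewrite natrK.
by apply/uprodE; apply: filterS filterT => i _; exists (n i).
Qed.

End UltrapowerOps.

(** * Internal cardinality of ultraproducts of finite sets *)

Lemma size_bij_iota (T : eqType) (R : numDomainType) (s : seq T) (m : nat)
    (h : T -> R) :
  uniq s ->
  {in s, forall x, exists2 k, (1 <= k <= m)%N & h x = k%:R} ->
  {in s &, injective h} ->
  (forall k, (1 <= k <= m)%N -> exists2 x, x \in s & h x = k%:R) ->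
  size s = m.
Proof.
move=> us hfun hinj hsurj.
rewrite -[RHS](size_iota 1) -(size_map h s).
rewrite -(size_map (fun k => k%:R : R) (iota 1 m)).
apply: perm_size; apply: uniq_perm.
- by rewrite map_inj_in_uniq.
- by rewrite map_inj_uniq ?iota_uniq//; apply: mulrIn; exact: oner_neq0.
- move=> y; apply/mapP/mapP => [[x /hfun[k km ->] ->]|[k]].
    by exists k; rewrite // mem_iota add1n ltnS.
  rewrite mem_iota add1n ltnS => /hsurj[x xs hx] ->.
  by exists x.
Qed.

Section Hypercard.
Variables (I : Type) (U : ultrafilter_on I) (R : realType).

Lemma has_hypercard_uprod (s : I -> {fset R}) :
  has_hypercard (uprod (U:=U) (fun i => [set` s i]))
    (ulim U (fun i => #|` s i|%:R)).
Proof.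
split; first by eexists.
  by apply/hypernatP; eexists.
(* Position in the enumeration of [s i], shifted because the target interval starts at 1. *)
pose H i (x : R) : R := (index x (s i)).+1%:R.
have HE (f g : I -> R) : U [set i | f i = g i] ->
    ulim U (fun i => H i (f i)) = ulim U (fun i => H i (g i)).
  by move=> fg; apply/ulimP; apply: filterS fg => i /= ->.
exists (fun x => ulim U (fun i => H i (repr x i))).
  by exists H => f; apply: HE; exact: repr_ulim.
have hE f : ulim U (fun i => H i (repr (ulim U f) i))
    = ulim U (fun i => H i (f i)) by apply: HE; exact: repr_ulim.
split.
- move=> _ [f /= Uf <-]; rewrite hE; split; first by apply/hypernatP; eexists.
  apply/andP; split; apply/ulim_le; apply: filterS Uf => i /= fs.
    by rewrite /H ler1n.
  by rewrite /H ler_nat index_mem.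
- move=> _ _ /set_mem[f /= Uf <-] /set_mem[g /= Ug <-].
  rewrite !hE => /ulimP fg; apply/ulimP.
  apply: filterS3 Uf Ug fg => i /= fs gs /eqP.
  rewrite /H eqr_nat eqSS => /eqP fg.
  by rewrite -(nth_index 0 fs) fg nth_index.
- move=> _ [/hypernatP[n ->] /andP[/ulim_le n1 /ulim_le ns]].
  pose f i : R := nth 0 (s i) (n i).-1.
  have nP : U [set i | (0 < n i <= #|` s i|)%N].
    by apply: filterS2 n1 ns => i /=; rewrite ler1n ler_nat => -> ->.
  exists (ulim U f).
    apply/uprodE; apply: filterS nP => i /= /andP[n0 ni].
    by rewrite /f mem_nth// -ltnS prednK.
  rewrite hE; apply/ulimP; apply: filterS nP => i /= /andP[n0 ni].
  by rewrite /H /f index_uniq ?fset_uniq ?prednK// -ltnS prednK.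
Qed.

(** An internal bijection is, at almost every index, a genuine bijection of [s i] with 1, ...,
    [m i]. This makes the choice by [xget] in [hypercard] unambiguous. *)
Lemma has_hypercard_uprod_uniq (s : I -> {fset R}) (N : ultrapower U R) :
  has_hypercard (uprod (U:=U) (fun i => [set` s i])) N ->
  N = ulim U (fun i => #|` s i|%:R).
Proof.
move=> [_ /hypernatP[m ->] [h [H hH] [hfun hinj hsurj]]].
have Hfun : U [set i | forall x, x \in s i ->
    exists2 k, (1 <= k <= m i)%N & H i x = k%:R].
  apply: (ultra_forall 0) => f; apply: ultra_imp => fs.
  have /hfun : uprod (U:=U) (fun i => [set` s i]) (ulim U f) by apply/uprodE.
  rewrite /= hH => -[/hypernatP[k Hk]].
  rewrite Hk => /andP[/ulim_le k1 /ulim_le km].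
  move/ulimP: Hk => Hk; apply: filterS3 Hk k1 km => i /= Hk.
  by rewrite ler1n ler_nat => k1 km; exists (k i); rewrite ?k1.
(* Pairs allow both points to be quantified by one use of [ultra_forall]. *)
have Hinj : U [set i | forall x, x.1 \in s i -> x.2 \in s i ->
    H i x.1 = H i x.2 -> x.1 = x.2].
  apply: (ultra_forall (0, 0)) => f.
  apply: ultra_imp => f1; apply: ultra_imp => f2; apply: ultra_imp => Hf.
  apply/(ulimP U (fun i => (f i).1) (fun i => (f i).2)); apply: hinj.
  - by apply/mem_set/uprodE.
  - by apply/mem_set/uprodE.
  - by rewrite !hH; apply/ulimP.
have Hsurj : U [set i | forall k, (1 <= k <= m i)%N ->
    exists2 x, x \in s i & H i x = k%:R].
  apply: (ultra_forall 0%N) => k; apply: ultra_imp => km.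
  have [|x Ax hx] := hsurj (ulim U (fun i => (k i)%:R)).
    split; first by apply/hypernatP; exists k.
    apply/andP; split; apply/ulim_le; apply: filterS km => i /= /andP[? ?].
      by rewrite ler1n.
    by rewrite ler_nat.
  case: Ax hx => f /= fs <-; rewrite hH => /ulimP Hf.
  by apply: filterS2 fs Hf => i /= ? ?; exists (f i).
apply/ulimP; apply: filterS3 Hfun Hinj Hsurj => i /= fi ii si.
congr _%:R; apply/esym/(size_bij_iota (fset_uniq _) fi) => // x y xs ys.
exact: (ii (x, y)).
Qed.

Lemma hypercard_uprod (a : I -> set R) :
  U [set i | finite_set (a i)] ->
  hypercard (uprod (U:=U) a) = ulim U (fun i => #|` fset_set (a i)|%:R).
Proof.
move=> afin; rewrite (@uprod_eq _ _ _ a (fun i => [set` fset_set (a i)])).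
  rewrite /hypercard; case: xgetP => [N _ /has_hypercard_uprod_uniq//|].
  (* A cardinality exists, so the default value of [xget] is excluded. *)
  by move=> /(_ _ (has_hypercard_uprod _)).
by apply: filterS afin => i /= ai; rewrite fset_setK.
Qed.

End Hypercard.

(** * Rigidity: internality forces the hyperrational ratios to be fixed *)

Section AdditiveFixed.
Variables (I : Type) (U : ultrafilter_on I) (R : realType).
Variables (phi : {rmorphism ultrapower U R -> ultrapower U R}).
Variables (c : I -> nat) (K : I -> nat -> R).
Hypothesis c_gt0 : U [set i | (0 < c i)%N].
Hypothesis phiK : forall n : I -> nat, U [set i | (n i <= c i)%N] ->
  phi (ulim U (fun i => (n i)%:R / (c i)%:R)) = ulim U (fun i => K i (n i)).

Lemma internal_ratio_fixed (n : I -> nat) : U [set i | (n i <= c i)%N] ->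
  phi (ulim U (fun i => (n i)%:R / (c i)%:R))
  = ulim U (fun i => (n i)%:R / (c i)%:R).
Proof.
(* For k varying with the index, this is additivity of [phi] on (k + 1)/c = k/c + 1/c. *)
have KS : U [set i | forall k, (k < c i)%N -> K i k.+1 = K i k + K i 1%N].
  apply: (ultra_forall 0%N) => k; apply: ultra_imp => kc.
  apply/(ulimP U (fun i => K i (k i).+1) (fun i => K i (k i) + K i 1%N)).
  rewrite -ulimD -!phiK//; last by apply: filterS kc => i /ltnW.
  rewrite -rmorphD ulimD; congr (phi (ulim U _)); apply/funext => i.
  by rewrite -mulrDl natr1.
have K0 : U [set i | K i 0%N = 0].
  apply/(ulimP U (fun i => K i 0%N) (fun=> 0)).
  rewrite -(phiK (n := fun=> 0%N)); last by apply: filterS filterT.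
  rewrite -[RHS](rmorph0 phi); congr (phi (ulim U _)).
  by apply/funext => i; rewrite mul0r.
have Kc : U [set i | K i (c i) = 1].
  apply/(ulimP U (fun i => K i (c i)) (fun=> 1)).
  rewrite -phiK; last by apply: filterS filterT => i _ /=.
  rewrite -[RHS](rmorph1 phi); congr (phi _); apply/ulimP.
  by apply: filterS c_gt0 => i /= ci; rewrite divff// pnatr_eq0 -lt0n.
move=> nc; rewrite phiK//; apply/ulimP.
apply: filterS3 (filterI nc KS) K0 (filterI Kc c_gt0).
move=> i /= [nci KSi] K0i [Kci ci].
(* The index is now fixed, so the induction is on a standard natural number; [Kci] then determines
   the slope. *)
have Kk k : (k <= c i)%N -> K i k = k%:R * K i 1%N.
  elim: k => [|k IHk] kc; first by rewrite K0i mul0r.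
  by rewrite KSi// IHk ?(ltnW kc)// -natr1 mulrDl mul1r.
have K1 : K i 1%N = (c i)%:R^-1.
  have ci0 : (c i)%:R != 0 :> R by rewrite pnatr_eq0 -lt0n.
  by apply: (mulfI ci0); rewrite -Kk// Kci divff.
by rewrite Kk// K1.
Qed.

End AdditiveFixed.

(** * The hyperfinite sample space as an ultraproduct *)

Section OmegaLambda.
Variables (R : realType) (Omega : set R).
Hypothesis Omega_neq0 : Omega !=set0.
Variable U : ultrafilter_on (finite_subsets Omega).
Hypothesis U_fine : fine_ultrafilter U.

Definition points (l : {fset Omega}) : set R := set_val @` [set` l].

Lemma points_finite l : finite_set (points l).
Proof. exact/finite_image/finite_fset. Qed.

(** By fineness, almost every l contains a chosen point of [Omega]. *)
Lemma fine_neq0 : U [set l : {fset Omega} | l != fset0].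
Proof.
have [x Ox] := Omega_neq0.
pose w : Omega := exist _ x (mem_set Ox).
apply: filterS (U_fine [fset w]%fset) => l /= wl.
by apply/eqP => l0; move: wl; rewrite l0 fsub1set inE.
Qed.

Lemma Omega_LambdaE : Omega_Lambda (U:=U) = uprod (U:=U) points.
Proof.
rewrite eqEsubset; split=> [_ [f /= fP <-]|_ [f /= fP <-]].
  apply/uprodE; apply: filterS fine_neq0 => l /= /fP[x xl ->].
  by exists x.
(* The selection [f] is correct only almost everywhere, while [Omega_Lambda] constrains every
   nonempty l; [g] repairs it at the exceptional indices within the same class. *)
have /choice[g gP] : forall l : {fset Omega}, exists y : R,
    (points l (f l) -> y = f l) /\
    (l != fset0 -> exists2 x : Omega, x \in l & y = set_val x).
  move=> l; have [[x xl xf]|nfl] := pselect (points l (f l)).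
    by exists (f l); split=> // _; exists x.
  have [l0|/fset0Pn[x xl]] := eqVneq l fset0; first by exists 0; split=> [/nfl|].
  by exists (set_val x); split=> // _; exists x.
exists g => /=; first by move=> l; have [] := gP l.
by apply/ulimP; apply: filterS fP => l /=; have [+ _] := gP l.
Qed.

Lemma uniform_probabilityE (A : internal_subsets (Omega_Lambda (U:=U)))
    (a : finite_subsets Omega -> set R) :
  set_val A = uprod (U:=U) a -> U [set l | a l `<=` points l] ->
  uniform_probability A =
  ulim U (fun l => #|` fset_set (a l)|%:R / #|` fset_set (points l)|%:R).
Proof.
move=> Aa aL; rewrite /uniform_probability Aa Omega_LambdaE !hypercard_uprod.
- exact: ulim_div.
- by apply: filterS filterT => l _; exact: points_finite.
- by apply: filterS aL => l /= /sub_finite_set; apply; exact: points_finite.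
Qed.

Lemma internal_subsets_Omega_Lambda :
  internal_subsets (Omega_Lambda (U:=U))
  = [set uprod (U:=U) a | a in [set a | U [set l | a l `<=` points l]]].
Proof.
rewrite Omega_LambdaE eqEsubset; split=> [_ [[a ->] /uprod_subset aL]|].
  by exists a.
by move=> _ [a /= aL <-]; split; [exists a|apply/uprod_subset].
Qed.

End OmegaLambda.

Theorem theorem2 (R : realType) (Omega : set R)
    (Omega_infinite : infinite_set Omega)
    (U : ultrafilter_on (finite_subsets Omega))
    (U_fine : fine_ultrafilter U) (U_free : free_ultrafilter U)
    (P : set Omega -> ultrapower U R)
    (P_probability : is_probability P) (P_limit : omega_limit_axiom P)
    (phi : {rmorphism ultrapower U R -> ultrapower U R})
    (phi_bij : bijective phi) :
  internal_setfun (phi \o @uniform_probability R Omega U) <->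
  (forall x : ultrapower U R,
     range (@uniform_probability R Omega U) x -> phi x = x).
Proof.
have Omega_neq0 := infinite_setN0 Omega_infinite.
pose c (l : {fset Omega}) := #|` fset_set (points l)|.
have aP (A : internal_subsets (Omega_Lambda (U:=U))) (a : _ -> set R) :
    set_val A = uprod (U:=U) a -> U [set l | a l `<=` points l].
  move=> Aa; have : internal_subsets (Omega_Lambda (U:=U)) (set_val A).
    exact: set_valP.
  by rewrite Aa Omega_LambdaE// => -[_ /uprod_subset].
split=> [[d [H [_ HP]]] x [A _ <-]|phi_fix].
  have : internal_subsets (Omega_Lambda (U:=U)) (set_val A) by exact: set_valP.
  move=> [[a Aa] _]; have aL := aP _ _ Aa.
  rewrite (uniform_probabilityE Omega_neq0 U_fine Aa aL).
  (* A canonical set of each size up to [c l], so that [H l] on it depends on [n] alone. *)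
  pose s (l : {fset Omega}) n : {fset R} := [fset x in take n (fset_set (points l))]%fset.
  have sE l n : (n <= c l)%N -> #|` s l n| = n.
    move=> nc; rewrite /s card_fseq undup_id ?take_uniq ?fset_uniq//.
    by rewrite size_takel.
  apply: (@internal_ratio_fixed _ U R phi c (fun l n => H l [set` s l n])).
  - apply: filterS (fine_neq0 Omega_neq0 U_fine) => l /= /fset0Pn[y yl].
    rewrite /c cardfs_gt0; apply/eqP => /fset_set_set0 => /(_ (points_finite l)).
    by apply/eqP/set0P; exists (set_val y), y.
  - move=> n nc; pose b l : set R := [set` s l (n l)].
    have bL : U [set l | b l `<=` points l].
      apply: filterS filterT => l _ z; rewrite /b /s /= inE => /mem_take.
      by rewrite in_fset_set ?inE//; exact: points_finite.
    have bi : internal_subsets (Omega_Lambda (U:=U)) (uprod (U:=U) b).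
      by rewrite internal_subsets_Omega_Lambda//; exists b.
    pose B : internal_subsets (Omega_Lambda (U:=U)) :=
      exist _ (uprod (U:=U) b) (mem_set bi).
    rewrite -(HP B b erefl) /= (uniform_probabilityE Omega_neq0 U_fine _ bL)//.
    congr (phi _); apply/ulimP; apply: filterS nc => l /= nl.
    by rewrite set_fsetK sE.
  - apply: filterS aL => l /= al; apply: fsubset_leq_card.
    rewrite -fset_set_sub//; last exact: points_finite.
    exact: sub_finite_set al (points_finite l).
(* Witnesses: all subsets of l, with the normalized counting measure. *)
exists (fun l => [set a | a `<=` points l]).
exists (fun l a => #|` fset_set a|%:R / (c l)%:R).
split; first exact: internal_subsets_Omega_Lambda.
move=> A a Aa /=; rewrite phi_fix; last by exists A.
exact: (uniform_probabilityE Omega_neq0 U_fine Aa (aP _ _ Aa)).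
Qed.
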